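(* Let $n=3k+r$ with integers $k\ge 2$ and $r\in\{0,1,2\}$. Then $$\gamma_{LD}(M(P_n))\le\begin{cases}2k+1 & \text{if } r=0,\\ 2k+2 & \text{if } r\in\{1,2\}.\end{cases}$$ Moreover, for every $n\ge 3$, $$\gamma_{LD}(M(C_n))\le\begin{cases} n-\left\lfloor\frac n3\right\rfloor+1 & \text{if } n \text{ is odd},\\ n-2\left\lfloor\frac n6\right\rfloor+1 & \text{if } n \text{ is even}.\end{cases}$$
   Context: All graphs are finite, simple and connected. For a graph $G=(V,E)$ and $x\in V$, $N(x)$ is the open neighbourhood and $N[x]=N(x)\cup\{x\}$. A set $C\subseteq V$ is a locating-dominating set ($LD$-set) if $N[x]\cap C\neq\emptyset$ for all $x\in V$ and $N(x)\cap C\neq N(y)\cap C$ for all distinct $x,y\in V\setminus C$; $\gamma_{LD}(G)$ is the minimum size of an $LD$-set. $P_n$ is the path and $C_n$ the cycle on $n$ vertices. The Mycielski graph $M(G)$ of $G$ with $V=\{v_1,\dots,v_n\}$ is obtained from $G$ by adding, for each $i$, a new vertex $u_i$ adjacent to every vertex of $N_G(v_i)$, and then adding one further vertex $u$ adjacent to all of $u_1,\dots,u_n$ (and to nothing else). *)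

(* Defs.v *)
From mathcomp Require Export all_boot.

Set Implicit Arguments.
Unset Strict Implicit.
Unset Printing Implicit Defensive.

Record sgraph := SGraph {
  vertex :> finType;
  adj : rel vertex;
  adj_sym : symmetric adj;
  adj_irrefl : irreflexive adj }.

Arguments adj {s}.

Section LocatingDomination.
Variable G : sgraph.
Implicit Types (x y : G) (C : {set G}).

Definition open_nbhd x : {set G} := [set y | adj x y].

Definition closed_nbhd x : {set G} := x |: open_nbhd x.

Definition LD_set C : bool :=
  [forall x, closed_nbhd x :&: C != set0] &&
  [forall x in ~: C, forall y in ~: C,
     (x != y) ==> (open_nbhd x :&: C != open_nbhd y :&: C)].

Definition gamma_LD : nat := #|[arg min_(C < [set: G] | LD_set C) #|C|]|.

Lemma LD_setT : LD_set [set: G].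
Proof.
apply/andP; split; last by apply/forallP => x; rewrite setCT inE.
by apply/forallP => x; apply/set0Pn; exists x; rewrite !inE eqxx.
Qed.

(* The default argument [set: G] of arg min is legitimate, so gamma_LD is the
   minimum cardinality of an LD-set. *)
Lemma gamma_LDP :
  (exists2 C, LD_set C & #|C| = gamma_LD) /\
  (forall C, LD_set C -> gamma_LD <= #|C|).
Proof.
rewrite /gamma_LD; case: arg_minnP => [|C ldC minC]; first exact: LD_setT.
by split=> //; exists C.
Qed.

End LocatingDomination.

Definition path_adj n : rel 'I_n :=
  fun i j => (i.+1 == j :> nat) || (j.+1 == i :> nat).

Lemma path_adj_sym n : symmetric (@path_adj n).
Proof. by move=> i j; rewrite /path_adj orbC. Qed.

Lemma path_adj_irrefl n : irreflexive (@path_adj n).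
Proof. by move=> i; rewrite /path_adj orbb eqn_leq ltnn. Qed.

Definition path_graph n : sgraph :=
  SGraph (@path_adj_sym n) (@path_adj_irrefl n).

(* ordS is the successor modulo n.  The conjunct i != j only matters for n = 1;
   the graph is the n-cycle when n >= 3. *)
Definition cycle_adj n : rel 'I_n :=
  fun i j => (i != j) && ((ordS i == j) || (ordS j == i)).

Lemma cycle_adj_sym n : symmetric (@cycle_adj n).
Proof. by move=> i j; rewrite /cycle_adj eq_sym orbC. Qed.

Lemma cycle_adj_irrefl n : irreflexive (@cycle_adj n).
Proof. by move=> i; rewrite /cycle_adj eqxx. Qed.

Definition cycle_graph n : sgraph :=
  SGraph (@cycle_adj_sym n) (@cycle_adj_irrefl n).

(* Some (inl v_i) is the original vertex v_i, Some (inr v_i) is its copy u_i,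
   and None is the additional vertex u. *)
Definition mycielski_adj (G : sgraph) : rel (option (G + G)) :=
  fun a b => match a, b with
  | Some (inl v), Some (inl w) => adj v w
  | Some (inl v), Some (inr w) => adj w v
  | Some (inr v), Some (inl w) => adj v w
  | Some (inr _), None | None, Some (inr _) => true
  | _, _ => false
  end.

Lemma mycielski_adj_sym (G : sgraph) : symmetric (@mycielski_adj G).
Proof. by move=> [[v|v]|] [[w|w]|] //=; exact: adj_sym. Qed.

Lemma mycielski_adj_irrefl (G : sgraph) : irreflexive (@mycielski_adj G).
Proof. by move=> [[v|v]|] //=; exact: adj_irrefl. Qed.

Definition mycielski (G : sgraph) : sgraph :=
  SGraph (@mycielski_adj_sym G) (@mycielski_adj_irrefl G).

(* Main.v *)
(* Take C = {u} :|: S with S a set of original vertices.  The copies u_i see u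
   and the v_i do not, and N(u_i) meets C in u and N(v_i) :&: S; so C is an
   LD-set as soon as the traces N(v) :&: S are pairwise distinct over all
   vertices v and every vertex outside S has a neighbour in S.  One trace may be
   empty, provided its vertex lies in S.
   In a path or a cycle, linking vertices at distance 2 splits the graph into
   paths or cycles whose edges are the sets N(v); the traces are distinct when
   at most one of them is empty and no vertex of S with two neighbours is
   isolated in S for this linking.  Dropping every third vertex along each piece
   gives the bounds.  The 4-cycle, whose pieces are double edges, needs a set
   containing copies. *)
Require Import Defs.
From mathcomp Require Import all_boot.
From mathcomp Require Import zify.

(** * Reduction to traces in an arbitrary graph *)

Lemma LD_set_separated (G : sgraph) (C : {set G}) :
    (forall x, x \notin C -> exists2 z, z \in C & adj x z) ->
    (forall x y, x \notin C -> y \notin C -> x != y ->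
       exists2 z, z \in C & adj x z != adj y z) ->
  LD_set C.
Proof.
move=> domC sepC; apply/andP; split.
  apply/forallP => x; apply/set0Pn.
  have [xC|/domC[z zC xz]] := boolP (x \in C).
    by exists x; rewrite !inE eqxx xC.
  by exists z; rewrite !inE xz zC orbT.
apply/forall_inP => x; rewrite inE => xC; apply/forall_inP => y.
rewrite inE => yC; apply/implyP => xy.
have [z zC] := sepC x y xC yC xy.
by apply: contraNneq => /setP/(_ z); rewrite !inE zC !andbT => ->.
Qed.

Lemma gamma_LD_mycielski_le (G : sgraph) (S : {set G}) :
    (forall v, v \notin S -> exists2 z, z \in S & adj v z) ->
    (forall v w, v != w -> exists2 z, z \in S & adj v z != adj w z) ->
  gamma_LD (mycielski G) <= #|S|.+1.
Proof.
move=> domS sepS.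
pose C : {set mycielski G} :=
  None |: [set (Some (inl v) : mycielski G) | v in S].
have inlC v : (Some (inl v) : mycielski G) \in C = (v \in S).
  rewrite !inE /=; apply/imsetP/idP => [[w wS [->]] //|vS]; by exists v.
have noneC : (None : mycielski G) \in C by rewrite !inE.
have cardC : #|C| <= #|S|.+1.
  rewrite cardsU1 -add1n leq_add ?leq_b1 //; exact: leq_imset_card.
apply: leq_trans cardC; apply: (proj2 (gamma_LDP _)).
apply: LD_set_separated => [[[v|v]|]|[[v|v]|] [[w|w]|]]; rewrite ?noneC ?inlC //.
- by move=> /domS[z zS vz]; exists (Some (inl z)); rewrite ?inlC.
- by exists None.
- move=> _ _ vw; have [|z zS sz] := sepS v w; first by apply: contraNneq vw => ->.
  by exists (Some (inl z)); rewrite ?inlC.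
- by exists None.
- by exists None.
- move=> _ _ vw; have [|z zS sz] := sepS v w; first by apply: contraNneq vw => ->.
  by exists (Some (inl z)); rewrite ?inlC.
Qed.

(** Equal nonempty traces force a common neighbour in [S], so separation only has to be tested on
    two neighbours of one [x] in [S]. The trace of [e] may be empty, but any pair contains a vertex
    other than [e] to start from. *)
Lemma gamma_LD_mycielski_local (G : sgraph) (S : {set G}) (e : G) :
    (forall v, v != e -> exists2 z, z \in S & adj v z) ->
    (e \notin S -> exists2 z, z \in S & adj e z) ->
    (forall x v w, x \in S -> adj x v -> adj x w -> v != w ->
       exists2 z, z \in S & adj v z != adj w z) ->
  gamma_LD (mycielski G) <= #|S|.+1.
Proof.
move=> domS dome sepS; apply: gamma_LD_mycielski_le => [v vS|].
  by have [ve|] := eqVneq v e; [rewrite ve; apply: dome; rewrite -ve|exact: domS].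
have sep v w : v != w -> v != e ->
    exists2 z, z \in S & adj v z != adj w z.
  move=> vw /domS[z zS vz]; case wz: (adj w z); last by exists z; rewrite ?vz ?wz.
  by apply: (sepS z) => //; rewrite adj_sym.
move=> v w vw; have [ve|] := eqVneq v e; last exact: sep.
have we : w != e by rewrite -ve eq_sym.
have wv : w != v by rewrite eq_sym.
by have [z zS zwv] := sep w v wv we; exists z; rewrite // eq_sym.
Qed.

(** Counting by omission: [f] lists [u] distinct dropped indices, which reduces each cardinality
    bound to arithmetic. *)
Lemma card_ord_set_le (n u : nat) (p : pred nat) (f : nat -> nat) :
    (forall t, t < u -> (f t < n) && ~~ p (f t)) ->
    (forall s t, s < u -> t < u -> f s = f t -> s = t) ->
  #|[set i : 'I_n | p i]| <= n - u.
Proof.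
move=> fP finj.
have fn (t : 'I_u) : f t < n by case/andP: (fP t (ltn_ord t)).
pose g (t : 'I_u) := Ordinal (fn t).
have ginj : injective g.
  by move=> s t [] /finj st; apply: val_inj; apply: st.
have sub : [set g t | t in 'I_u] \subset ~: [set i : 'I_n | p i].
  apply/subsetP => _ /imsetP[t _ ->]; rewrite !inE /=.
  by case/andP: (fP t (ltn_ord t)).
have := subset_leq_card sub; rewrite card_imset // card_ord.
have := cardsC [set i : 'I_n | p i]; rewrite card_ord; lia.
Qed.

(** * Criterion for paths *)

Lemma gamma_LD_mycielski_path (n e : nat) (p : pred nat) :
    e < n ->
    (forall i, i < n -> i != e \/ ~~ p e ->
       (0 < i) && p i.-1 || (i.+1 < n) && p i.+1) ->
    (forall x, 0 < x -> x.+1 < n -> p x ->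
       (1 < x) && p x.-2 || (x.+2 < n) && p x.+2) ->
  gamma_LD (mycielski (path_graph n)) <= #|[set i : 'I_n | p i]|.+1.
Proof.
move=> en dom iso.
have nbr (i : 'I_n) : i != e :> nat \/ ~~ p e ->
    exists2 z : path_graph n, z \in [set i : 'I_n | p i] & @adj (path_graph n) i z.
  case/(dom i (ltn_ord i))/orP => /andP[lt pz].
    have lt' : i.-1 < n by have := ltn_ord i; lia.
    by exists (Ordinal lt'); rewrite ?inE //= /path_adj /=; lia.
  by exists (Ordinal lt); rewrite ?inE //= /path_adj /= eqxx.
apply: (@gamma_LD_mycielski_local (path_graph n) _ (Ordinal en)) => [v ve||].
- by apply: nbr; left; apply: contraNneq ve => ve; apply/eqP/val_inj.
- by rewrite inE /= => pe; apply: nbr; right.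
(* Here [v] and [w] are x-1 and x+1 in some order. Among these, x-2 is adjacent only to x-1 and x+2
   only to x+1, so either one separates them. *)
move=> x v w; rewrite inE /= /path_adj => px xv xw vw.
have {}vw : v != w :> nat by apply: contraNneq vw => vw; apply/eqP/val_inj.
have vn := ltn_ord v; have wn := ltn_ord w.
have x0 : 0 < x by lia.
have xn : x.+1 < n by lia.
have /orP[/andP[lt pz]|/andP[lt pz]] := iso x x0 xn px.
  have lt' : x.-2 < n by lia.
  by exists (Ordinal lt'); rewrite ?inE //=; lia.
by exists (Ordinal lt); rewrite ?inE //=; lia.
Qed.

(** * Neighbours on a cycle and the criterion for cycles *)

Definition cycle_next (n i : nat) := if i.+1 == n then 0 else i.+1.
Definition cycle_prev (n i : nat) := if i == 0 then n.-1 else i.-1.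

(** Wrapping around by a case split instead of a remainder keeps index computations linear, within
    reach of [lia]. *)
Lemma cycle_nextE n i :
  (i.+1 = n /\ cycle_next n i = 0) \/ (i.+1 != n /\ cycle_next n i = i.+1).
Proof. by rewrite /cycle_next; case: eqP; [left|right]. Qed.

Lemma cycle_prevE n i :
  (i = 0 /\ cycle_prev n i = n.-1) \/ (0 < i /\ cycle_prev n i = i.-1).
Proof. by case: i => [|i]; [left|right]. Qed.

Section CycleSteps.
Variables (n i : nat).
Hypothesis ltin : i < n.

Lemma cycle_nextK : cycle_prev n (cycle_next n i) = i.
Proof.
by have := cycle_nextE n i; have := cycle_prevE n (cycle_next n i); lia.
Qed.

Lemma cycle_prevK : cycle_next n (cycle_prev n i) = i.
Proof.
by have := cycle_prevE n i; have := cycle_nextE n (cycle_prev n i); lia.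
Qed.

Hypothesis n_gt2 : 2 < n.

Lemma cycle_next2_neq : cycle_next n (cycle_next n i) != i.
Proof.
by have := cycle_nextE n i; have := cycle_nextE n (cycle_next n i); lia.
Qed.

Lemma cycle_prev2_neq : cycle_prev n (cycle_prev n i) != i.
Proof.
by have := cycle_prevE n i; have := cycle_prevE n (cycle_prev n i); lia.
Qed.

(** Two steps back and two steps forward meet only when n divides 4. *)
Lemma cycle_prev2_neq_next2 : n != 4 ->
  cycle_prev n (cycle_prev n i) != cycle_next n (cycle_next n i).
Proof.
have := cycle_nextE n i; have := cycle_nextE n (cycle_next n i).
by have := cycle_prevE n i; have := cycle_prevE n (cycle_prev n i); lia.
Qed.
End CycleSteps.

Lemma cycle_adjE (n : nat) (i j : 'I_n) : 2 < n ->
  cycle_adj i j = (j == cycle_next n i :> nat) || (j == cycle_prev n i :> nat).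
Proof.
move=> n2.
have ordSE (k l : 'I_n) : (ordS k == l) = (l == cycle_next n k :> nat).
  rewrite -val_eqE /= /cycle_next eq_sym; congr (_ == _).
  by case: eqP => [->|kn]; rewrite ?modnn // modn_small //; have := ltn_ord k; lia.
rewrite /cycle_adj !ordSE -val_eqE /=.
have := cycle_nextE n i; have := cycle_nextE n j; have := cycle_prevE n i.
have := ltn_ord i; have := ltn_ord j; lia.
Qed.

Lemma gamma_LD_mycielski_cycle (n : nat) (p : pred nat) :
    2 < n -> n != 4 ->
    (forall i, i < n -> p (cycle_prev n i) || p (cycle_next n i)) ->
    (forall x, x < n -> p x ->
       p (cycle_prev n (cycle_prev n x)) || p (cycle_next n (cycle_next n x))) ->
  gamma_LD (mycielski (cycle_graph n)) <= #|[set i : 'I_n | p i]|.+1.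
Proof.
move=> n2 n4 dom iso.
have nextP i : i < n -> cycle_next n i < n by have := cycle_nextE n i; lia.
have prevP i : i < n -> cycle_prev n i < n by have := cycle_prevE n i; lia.
have nbr (i : 'I_n) :
    exists2 z : cycle_graph n, z \in [set i : 'I_n | p i] & @adj (cycle_graph n) i z.
  case/orP: (dom i (ltn_ord i)) => pz.
    by exists (Ordinal (prevP i (ltn_ord i))); rewrite ?inE //= cycle_adjE //= eqxx orbT.
  by exists (Ordinal (nextP i (ltn_ord i))); rewrite ?inE //= cycle_adjE //= eqxx.
(* Every vertex has a neighbour in the set, so any vertex can serve as [e]. *)
have n0 : 0 < n by lia.
apply: (@gamma_LD_mycielski_local (cycle_graph n) _ (Ordinal n0)) => [v _||].
- exact: nbr.
- by move=> _; apply: nbr.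
move=> x v w; rewrite inE /= !cycle_adjE // => px xv xw vw.
have {}vw : v != w :> nat by apply: contraNneq vw => vw; apply/eqP/val_inj.
have xn := ltn_ord x; have vn := ltn_ord v; have wn := ltn_ord w.
have pn := cycle_nextK _ _ xn; have np := cycle_prevK _ _ xn.
have ppnn := cycle_prev2_neq_next2 _ _ xn n2 n4.
have ppx := cycle_prev2_neq _ _ xn n2; have nnx := cycle_next2_neq _ _ xn n2.
(* The vertex two steps from [x] on one side is adjacent to the neighbour of [x] on that side. It
   misses the other neighbour because it is neither [x] (n > 2) nor the vertex two steps away on the
   other side (n != 4). *)
case/orP: xv => /eqP xv; case/orP: xw => /eqP xw;
  rewrite ?xv ?xw ?eqxx // in vw;
  (have /orP[pz|pz] := iso x xn px;
   [ exists (Ordinal (prevP _ (prevP _ xn)))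
   | exists (Ordinal (nextP _ (nextP _ xn))) ]);
  rewrite ?inE // !cycle_adjE //= xv xw pn np !eqxx ?orbT /=;
  by rewrite ?(negPf ppnn) ?[_ == cycle_prev n _]eq_sym ?(negPf ppnn) ?(negPf ppx) ?(negPf nnx).
Qed.

(** * Path bounds, by n modulo 6 *)

Lemma gamma_LD_mycielski_path0 j : 0 < j ->
  gamma_LD (mycielski (path_graph (6 * j))) <= 4 * j + 1.
Proof.
(* Each block of six drops one even and one odd index, hence every third vertex of each parity
   chain. No trace is empty: [e = 0] is itself dropped, so it must be dominated too. *)
move=> j0; pose p i := (i %% 6 != 0) && (i %% 6 != 5).
apply: leq_trans (@gamma_LD_mycielski_path _ 0 p _ _ _) _; try (rewrite /p; lia).
apply: leq_ltn_trans (@card_ord_set_le _ (2 * j) p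
  (fun t => 6 * (t %/ 2) + 5 * (t %% 2)) _ _) _ => [t|s t|];
  rewrite /p; lia.
Qed.

Lemma gamma_LD_mycielski_path1 j : 0 < j ->
  gamma_LD (mycielski (path_graph (6 * j + 1))) <= 4 * j + 2.
Proof.
move=> j0.
(* The last vertex 6j is dropped, so its only neighbour 6j-1 is put back. *)
pose p i := (i %% 6 != 0) && (i %% 6 != 5) || (i == 6 * j - 1).
apply: leq_trans (@gamma_LD_mycielski_path _ 0 p _ _ _) _; try (rewrite /p; lia).
apply: leq_ltn_trans (@card_ord_set_le _ (2 * j) p
  (fun t => if t.+1 < 2 * j then 6 * (t %/ 2) + 5 * (t %% 2) else 6 * j) _ _) _ => [t|s t|];
  rewrite /p; do ?[case: ifP => ?]; lia.
Qed.

Lemma gamma_LD_mycielski_path2 j : 0 < j ->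
  gamma_LD (mycielski (path_graph (6 * j + 2))) <= 4 * j + 2.
Proof.
(* The end vertex 6j+1 is kept and its only neighbour 6j is dropped: it takes the one empty
   trace. *)
move=> j0; pose p i := (i %% 6 != 0) && (i %% 6 != 5).
apply: leq_trans (@gamma_LD_mycielski_path _ (6 * j + 1) p _ _ _) _;
  try (rewrite /p; lia).
apply: leq_ltn_trans (@card_ord_set_le _ (2 * j + 1) p
  (fun t => 6 * (t %/ 2) + 5 * (t %% 2)) _ _) _ => [t|s t|];
  rewrite /p; lia.
Qed.

Lemma gamma_LD_mycielski_path3 j : 0 < j ->
  gamma_LD (mycielski (path_graph (6 * j + 3))) <= 4 * j + 3.
Proof.
move=> j0.
(* The shifted pattern gives the empty trace to 0. The index 6j+1 is put back to dominate the
   dropped last vertex 6j+2. *)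
pose p i := (i %% 6 != 1) && (i %% 6 != 2) || (i == 6 * j + 1).
apply: leq_trans (@gamma_LD_mycielski_path _ 0 p _ _ _) _; try (rewrite /p; lia).
apply: leq_ltn_trans (@card_ord_set_le _ (2 * j + 1) p
  (fun t => if t < 2 * j then 6 * (t %/ 2) + t %% 2 + 1 else 6 * j + 2) _ _) _ => [t|s t|];
  rewrite /p; do ?[case: ifP => ?]; lia.
Qed.

Lemma gamma_LD_mycielski_path4 j :
  gamma_LD (mycielski (path_graph (6 * j + 4))) <= 4 * j + 4.
Proof.
(* Dropping every third index does the same in each parity chain; the empty trace is at the kept end
   6j+3. *)
pose p i := i %% 3 != 2.
apply: leq_trans (@gamma_LD_mycielski_path _ (6 * j + 3) p _ _ _) _;
  try (rewrite /p; lia).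
apply: leq_ltn_trans (@card_ord_set_le _ (2 * j + 1) p
  (fun t => 3 * t + 2) _ _) _ => [t|s t|];
  rewrite /p; lia.
Qed.

Lemma gamma_LD_mycielski_path5 j :
  gamma_LD (mycielski (path_graph (6 * j + 5))) <= 4 * j + 4.
Proof.
(* With 0 dropped as well, the kept vertex 1 has the empty trace. *)
pose p i := (i %% 3 != 2) && (i != 0).
apply: leq_trans (@gamma_LD_mycielski_path _ 1 p _ _ _) _; try (rewrite /p; lia).
apply: leq_ltn_trans (@card_ord_set_le _ (2 * j + 2) p
  (* By truncated subtraction, t = 0 lists the extra dropped vertex 0. *)
  (fun t => 3 * t - 1) _ _) _ => [t|s t|];
  rewrite /p; lia.
Qed.

(** * Cycle bounds *)

Lemma gamma_LD_mycielski_cycle_even n : 2 < n -> n != 4 -> ~~ odd n ->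
  gamma_LD (mycielski (cycle_graph n)) <= n - 2 * (n %/ 6) + 1.
Proof.
(* The even and the odd indices form two linked cycles. Residues 0 and 1 drop one vertex of each per
   complete block of six; the incomplete block is kept whole. *)
move=> n2 n4 evn; pose p i := (1 < i %% 6) || (6 * (n %/ 6) <= i).
apply: leq_trans (@gamma_LD_mycielski_cycle n p _ _ _ _) _ => //;
  [rewrite /p => i _|rewrite /p => i _ _|].
- have := cycle_nextE n i; have := cycle_prevE n i; lia.
- have := cycle_nextE n i; have := cycle_nextE n (cycle_next n i).
  have := cycle_prevE n i; have := cycle_prevE n (cycle_prev n i); lia.
apply: leq_ltn_trans (@card_ord_set_le _ (2 * (n %/ 6)) p
  (fun t => 6 * (t %/ 2) + t %% 2) _ _) _ => [t|s t|]; rewrite /p; lia.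
Qed.

(* For odd n the vertices form a single cycle under i |-> i + 2; index i is the
   position of i in it, counted from 0. *)
Lemma gamma_LD_mycielski_cycle_odd n : 2 < n -> odd n ->
  gamma_LD (mycielski (cycle_graph n)) <= n - n %/ 3 + 1.
Proof.
move=> n2 oddn; pose index i := if odd i then (i + n) %/ 2 else i %/ 2.
have indexE i : (2 * index i = i \/ 2 * index i = i + n).
  by rewrite /index; case: ifP; lia.
(* Only the relation of [2 * index i] to [i] modulo n is kept; it is linear and, n being odd,
   determines the position. *)
move: index indexE => index indexE.
pose p i := (index i %% 3 != 0) || (3 * (n %/ 3) <= index i).
apply: leq_trans (@gamma_LD_mycielski_cycle n p _ _ _ _) _ => //;
  [lia|rewrite /p => i ltin|rewrite /p => i ltin|].
- have := cycle_nextE n i; have := cycle_prevE n i.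
  have := indexE (cycle_next n i); have := indexE (cycle_prev n i); lia.
- have := cycle_nextE n i; have := cycle_nextE n (cycle_next n i).
  have := cycle_prevE n i; have := cycle_prevE n (cycle_prev n i).
  have := indexE (cycle_next n (cycle_next n i)).
  have := indexE (cycle_prev n (cycle_prev n i)); have := indexE i; lia.
(* Position 3t is held by the vertex 6t modulo n; as 6t < 2n, one subtraction suffices. *)
apply: leq_ltn_trans (@card_ord_set_le _ (n %/ 3) p
  (fun t => if 6 * t < n then 6 * t else 6 * t - n) _ _) _ => [t|s t|];
  rewrite /p; last lia.
  by case: ifP => ? ?; [have := indexE (6 * t)|have := indexE (6 * t - n)]; lia.
by do 2![case: ifP => ?]; lia.
Qed.

Lemma gamma_LD_mycielski_cycle4 : gamma_LD (mycielski (cycle_graph 4)) <= 4.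
Proof.
pose v k : mycielski (cycle_graph 4) := Some (inl (inord k)).
pose u k : mycielski (cycle_graph 4) := Some (inr (inord k)).
(* Opposite vertices of the 4-cycle have equal neighbourhoods, and so do their copies: [C] takes one
   vertex from each of the four twin pairs. The vertices v2, v3, u2, u3, u have traces {v1,u1},
   {v0,u0}, {v1}, {v0}, {u0,u1}. *)
pose C : {set mycielski (cycle_graph 4)} := [set v 0; v 1; u 0; u 1].
have ordP (i : 'I_4) : i \in [:: inord 0; inord 1; inord 2; inord 3].
  by rewrite !inE -!val_eqE /= !inordK //; case: i => -[|[|[|[]]]].
have outC x : x \notin C -> x \in [:: v 2; v 3; u 2; u 3; None].
  case: x => [[i|i]|] //; have := ordP i; rewrite !inE /=;
    by do ![case/orP=> [/eqP->|]]; first [move/eqP->|idtac]; rewrite ?eqxx ?orbT.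
have adjE (i j : nat) : i < 4 -> j < 4 ->
    cycle_adj (inord i : 'I_4) (inord j) = (i != j) && ((i.+1 %% 4 == j) || (j.+1 %% 4 == i)).
  by move=> i4 j4; rewrite /cycle_adj -!val_eqE /= !inordK.
have inC : [/\ v 0 \in C, v 1 \in C, u 0 \in C & u 1 \in C].
  by split; rewrite !inE eqxx ?orbT.
case: inC => v0 v1 u0 u1.
have cardC : #|C| <= 4.
  by rewrite /C -!setUA; do ![rewrite cardsU1]; rewrite cards1; do !case: (_ \notin _).
apply: leq_trans cardC; apply: (proj2 (gamma_LDP _)).
apply: LD_set_separated => [x /outC|x y /outC xO /outC yO]; rewrite ?inE.
  do ![case/orP=> [/eqP->|]]; last move/eqP->;
  by [ exists (v 0); rewrite //= adjE | exists (v 1); rewrite //= adjE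
     | exists (u 0); rewrite //= adjE].
move: xO yO; rewrite !inE.
by do ![case/orP=> [/eqP->|]]; try move/eqP->;
  do ?[case/orP=> [/eqP->|]]; try move/eqP->; rewrite ?eqxx // => _;
  first [ by exists (v 0); rewrite //= ?adjE | by exists (v 1); rewrite //= ?adjE
     | by exists (u 0); rewrite //= ?adjE | by exists (u 1); rewrite //= ?adjE].
Qed.

Theorem theorem7 :
  (forall n k r : nat, n = 3 * k + r -> 2 <= k -> r < 3 ->
     gamma_LD (mycielski (path_graph n))
       <= if r == 0 then 2 * k + 1 else 2 * k + 2)
  /\
  (forall n : nat, 3 <= n ->
     gamma_LD (mycielski (cycle_graph n))
       <= if odd n then n - n %/ 3 + 1 else n - 2 * (n %/ 6) + 1).
Proof.
split=> [n k r nE k2 r3|n n3]; last first.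
  case: ifPn => oddn; first exact: gamma_LD_mycielski_cycle_odd.
  have [->|n4] := eqVneq n 4; last exact: gamma_LD_mycielski_cycle_even.
  exact: leq_trans gamma_LD_mycielski_cycle4 _.
(* The parity of [k] together with [r] gives n modulo 6. *)
pose j := k %/ 2.
have [kE|kE] : k = 2 * j \/ k = 2 * j + 1 by lia.
  have j0 : 0 < j by lia.
  case: r nE r3 => [|[|[|//]]] nE _ /=.
  - have -> : n = 6 * j by lia.
    by apply: leq_trans (gamma_LD_mycielski_path0 _ j0) _; lia.
  - have -> : n = 6 * j + 1 by lia.
    by apply: leq_trans (gamma_LD_mycielski_path1 _ j0) _; lia.
  - have -> : n = 6 * j + 2 by lia.
    by apply: leq_trans (gamma_LD_mycielski_path2 _ j0) _; lia.
case: r nE r3 => [|[|[|//]]] nE _ /=.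
- have -> : n = 6 * j + 3 by lia.
  by apply: leq_trans (gamma_LD_mycielski_path3 j _) _; lia.
- have -> : n = 6 * j + 4 by lia.
  by apply: leq_trans (gamma_LD_mycielski_path4 _) _; lia.
- have -> : n = 6 * j + 5 by lia.
  by apply: leq_trans (gamma_LD_mycielski_path5 _) _; lia.
Qed.
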